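(* Let $\alpha,\beta,\gamma\in\mathbb{R}$ with $\gamma\neq0$, and let $G_2$ be the connected, simply connected three-dimensional Lie group with left-invariant Lorentzian metric $g$ whose Lie algebra has a pseudo-orthonormal basis $\{\widetilde e_1,\widetilde e_2,\widetilde e_3\}$, with $\widetilde e_3$ timelike, satisfying $$[\widetilde e_1,\widetilde e_2]=\gamma\widetilde e_2-\beta\widetilde e_3,\quad [\widetilde e_1,\widetilde e_3]=-\beta\widetilde e_2-\gamma\widetilde e_3,\quad [\widetilde e_2,\widetilde e_3]=\alpha\widetilde e_1.$$ Let $\nabla^B$ be the Bott connection and $\widetilde\rho^B$ its symmetrized Ricci tensor. Then $(G_2,\nabla^B,\widetilde\rho^B)$ is a quasi-statistical structure if and only if $\alpha=\beta=0$ and $\gamma\neq0$.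
   Context: Basis vectors are identified with left-invariant vector fields on the group $G$; $g(\widetilde e_1,\widetilde e_1)=g(\widetilde e_2,\widetilde e_2)=1$, $g(\widetilde e_3,\widetilde e_3)=-1$, and $g(\widetilde e_i,\widetilde e_j)=0$ for $i\ne j$. Let $\nabla^L$ be the Levi-Civita connection of $g$, $D=\mathrm{span}\{\widetilde e_1,\widetilde e_2\}$, $D^\perp=\mathrm{span}\{\widetilde e_3\}$ (distributions on $G$), with associated projections $\pi_D,\pi_{D^\perp}$ of $TG=D\oplus D^\perp$. The Bott connection $\nabla^B$ is the linear connection given by: $\nabla^B_XY=\pi_D(\nabla^L_XY)$ for $X,Y\in\Gamma^\infty(D)$; $\nabla^B_XY=\pi_D([X,Y])$ for $X\in\Gamma^\infty(D^\perp),Y\in\Gamma^\infty(D)$; $\nabla^B_XY=\pi_{D^\perp}([X,Y])$ for $X\in\Gamma^\infty(D),Y\in\Gamma^\infty(D^\perp)$; $\nabla^B_XY=\pi_{D^\perp}(\nabla^L_XY)$ for $X,Y\in\Gamma^\infty(D^\perp)$. Curvature: $R^B(X,Y)Z=\nabla^B_X\nabla^B_YZ-\nabla^B_Y\nabla^B_XZ-\nabla^B_{[X,Y]}Z$. Ricci tensor: $\rho^B(X,Y)=-g(R^B(X,\widetilde e_1)Y,\widetilde e_1)-g(R^B(X,\widetilde e_2)Y,\widetilde e_2)+g(R^B(X,\widetilde e_3)Y,\widetilde e_3)$. Symmetrized Ricci tensor: $\widetilde\rho^B(X,Y)=\tfrac12(\rho^B(X,Y)+\rho^B(Y,X))$.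 For a linear connection $\nabla$ with torsion $T(X,Y)=\nabla_XY-\nabla_YX-[X,Y]$ and a $(0,2)$ tensor field $\omega$, put $(\nabla_X\omega)(Y,Z)=X[\omega(Y,Z)]-\omega(\nabla_XY,Z)-\omega(Y,\nabla_XZ)$. The triple $(G,\nabla,\omega)$ is called a quasi-statistical structure if $(\nabla_X\omega)(Y,Z)-(\nabla_Y\omega)(X,Z)+\omega(T(X,Y),Z)=0$ for all vector fields $X,Y,Z$. *)

(* Defs.v *)
From HB Require Import structures.
From mathcomp Require Import all_boot all_order all_algebra.
From mathcomp Require Import ring.
From mathcomp Require Import all_classical all_reals all_analysis.
Import Order.TTheory GRing.Theory Num.Theory.
Import numFieldNormedType.Exports.

Set Implicit Arguments.
Unset Strict Implicit.
Unset Printing Implicit Defensive.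

Local Open Scope classical_set_scope.
Local Open Scope ring_scope.

Section Ck.
Variables (R : realType) (E F : normedModType R).

(* In finite dimension this is the usual notion of C^k map on an open set U:
   [df] is the Frechet derivative of f on U, and x |-> df x is C^k iff all
   x |-> df x v are. *)
Fixpoint Ck (k : nat) (U : set E) (f : E -> F) : Prop :=
  if k is k'.+1 then
    exists df : E -> E -> F, (forall x, U x -> is_diff x f (df x)) /\
                             (forall v, Ck k' U (df ^~ v))
  else forall x, U x -> {for x, continuous f}.

Definition smooth_on (U : set E) (f : E -> F) : Prop := forall k, Ck k U f.

Lemma Ck_le1 k U f : Ck k.+1 U f -> Ck k U f.
Proof.
elim: k f => [|k IH] f [df [dfP Cdf]] /=.
  by move=> x /dfP dx; apply: differentiable_continuous; exact: ex_diff.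
by exists df; split=> // v; apply: IH.
Qed.

Lemma Ck_cst k U c : Ck k U (fun=> c).
Proof.
elim: k c => [|k IH] c /=; first by move=> x _; exact: cst_continuous.
by exists (fun _ _ => 0); split=> [x _|v]; [exact: is_diff_cst | exact: IH].
Qed.

Lemma CkD k U f g : Ck k U f -> Ck k U g -> Ck k U (f + g).
Proof.
elim: k f g => [|k IH] f g /= => [Cf Cg x Ux|].
  by apply: continuousD; [exact: Cf | exact: Cg].
case=> df [dfP Cdf] [dg [dgP Cdg]]; exists (fun x => df x + dg x).
split=> [x Ux|v]; last by apply: IH; [exact: Cdf | exact: Cdg].
by have dx := dfP x Ux; have dy := dgP x Ux; exact: is_diffD.
Qed.

Lemma CkZ k U (a : R) f : Ck k U f -> Ck k U (a *: f).
Proof.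
elim: k f => [|k IH] f /= => [Cf x Ux|].
  by apply: continuousZl_tmp; exact: Cf.
case=> df [dfP Cdf]; exists (fun x => a *: df x).
split=> [x Ux|v]; last by apply: IH; exact: Cdf.
by have dx := dfP x Ux; exact: is_diffZ.
Qed.

End Ck.

Lemma CkM (R : realType) (E : normedModType R) k (U : set E) (f g : E -> R) :
  Ck k U f -> Ck k U g -> Ck k U (f * g).
Proof.
elim: k f g => [|k IH] f g => [/= Cf Cg x Ux|Cf Cg].
  by apply: continuousM; [exact: Cf | exact: Cg].
have Cf' := Ck_le1 Cf; have Cg' := Ck_le1 Cg.
case: Cf Cg => df [dfP Cdf] [dg [dgP Cdg]].
exists (fun x => f x *: dg x + g x *: df x); split=> [x Ux|v].
  by have dx := dfP x Ux; have dy := dgP x Ux; exact: is_diffM.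
apply: (@CkD _ _ _ k U (f * (dg ^~ v)) (g * (df ^~ v))); apply: IH.
- exact: Cf'.
- exact: Cdg.
- exact: Cg'.
- exact: Cdf.
Qed.

(* A chart of M modelled on E; [chart_inv] is only meaningful on the image of
   [chart_dom]. *)
Record chart (E M : Type) := Chart {
  chart_dom : set M;
  chart_map :> M -> E;
  chart_inv : E -> M }.

Definition is_chart (E M : topologicalType) (c : chart E M) : Prop :=
  [/\ open (chart_dom c), open (c @` chart_dom c),
      (forall p, chart_dom c p -> chart_inv c (c p) = p),
      (forall p, chart_dom c p -> {for p, continuous c}) &
      (forall x, (c @` chart_dom c) x -> {for x, continuous (chart_inv c)})].

Definition prod_chart (E F M N : Type) (c : chart E M) (d : chart F N) :
    chart (E * F) (M * N) :=
  Chart (chart_dom c `*` chart_dom d) (fun p => (c p.1, d p.2))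
        (fun z => (chart_inv c z.1, chart_inv d z.2)).

Definition smooth_in_charts (R : realType) (E F : normedModType R) (M N : Type)
    (c : chart E M) (d : chart F N) (f : M -> N) : Prop :=
  smooth_on (c @` (chart_dom c `&` f @^-1` chart_dom d))
            (fun x => d (f (chart_inv c x))).

Definition smooth_map (R : realType) (E F : normedModType R)
    (M N : topologicalType) (A : set (chart E M)) (B : set (chart F N))
    (f : M -> N) : Prop :=
  continuous f /\ forall c d, A c -> B d -> smooth_in_charts c d f.

HB.mixin Record isSmoothManifold (R : realType) (n : nat) M of Topological M := {
  atlas : set (chart 'rV[R]_n M);
  manifold_hausdorff : hausdorff_space M;
  manifold_second_countable : @second_countable M;
  atlas_chart : forall c, atlas c -> is_chart c;
  atlas_cover : forall p : M, exists2 c, atlas c & chart_dom c p;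
  atlas_compatible : forall c d, atlas c -> atlas d -> smooth_in_charts c d id
}.

#[short(type="smoothManifoldType")]
HB.structure Definition SmoothManifold (R : realType) (n : nat) :=
  {M of isSmoothManifold R n M & Topological M}.

Arguments atlas {R n} s : rename.

Definition prod_atlas (R : realType) (n m : nat) (M : smoothManifoldType R n)
    (N : smoothManifoldType R m) : set (chart ('rV[R]_n * 'rV[R]_m) (M * N)) :=
  [set e | exists c d, [/\ atlas M c, atlas N d & e = prod_chart c d]].

HB.mixin Record isLieGroup (R : realType) (n : nat) G
    of SmoothManifold R n G & Group G := {
  mulg_smooth : smooth_map (@prod_atlas R n n G G) (atlas G)
                           (fun p : G * G => (p.1 * p.2)%g);
  invg_smooth : smooth_map (atlas G) (atlas G) (fun p : G => (p^-1)%g)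
}.

#[short(type="lieGroupType")]
HB.structure Definition LieGroup (R : realType) (n : nat) :=
  {G of isLieGroup R n G & SmoothManifold R n G & Group G}.

Definition simply_connected (R : realType) (T : topologicalType) : Prop :=
  (forall p q : T, exists c : R -> T,
     [/\ {within `[0, 1], continuous c}, c 0 = p & c 1 = q]) /\
  (forall c : R -> T, {within `[0, 1], continuous c} -> c 0 = c 1 ->
     exists H : R * R -> T,
       [/\ {within `[0, 1] `*` `[0, 1], continuous H},
           (forall s, s \in `[0, 1] -> H (s, 0) = c s /\ H (s, 1) = c 0) &
           (forall t, t \in `[0, 1] -> H (0, t) = c 0 /\ H (1, t) = c 0)]).

Section Manifold.
Variables (R : realType) (n : nat) (M : smoothManifoldType R n).

Definition is_smooth (f : M -> R) : Prop :=
  forall c, atlas M c -> smooth_on (c @` chart_dom c) (f \o chart_inv c).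

Definition smooth_pred : {pred (M -> R)} := fun f => `[< is_smooth f >].

Record smooth_fun := SmoothFun {
  smooth_val :> M -> R; _ : smooth_val \in smooth_pred }.

HB.instance Definition _ := [isSub for smooth_val].
HB.instance Definition _ := [Choice of smooth_fun by <:].

Lemma smooth_subring_closed : subring_closed smooth_pred.
Proof.
split=> [|f g /asboolP fP /asboolP gP|f g /asboolP fP /asboolP gP];
  apply/asboolP => c cA k.
- exact: Ck_cst.
- have -> : (f - g) \o chart_inv c = f \o chart_inv c + -1 *: (g \o chart_inv c).
    by rewrite scaleN1r.
  by apply: CkD; [exact: fP | apply: CkZ; exact: gP].
- by apply: (@CkM _ _ k _ (f \o chart_inv c)); [exact: fP | exact: gP].
Qed.

HB.instance Definition _ := GRing.SubChoice_isSubComPzRing.Build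
  (M -> R) smooth_pred smooth_fun smooth_subring_closed.

Lemma smooth_subsemimod_closed : GRing.subsemimod_closed smooth_pred.
Proof.
apply: GRing.submod_closed_semi; split.
  by apply/asboolP => c cA k; exact: Ck_cst.
move=> a f g /asboolP fP /asboolP gP; apply/asboolP => c cA k.
apply: (@CkD _ _ _ k _ (a *: (f \o chart_inv c))); last exact: gP.
by apply: CkZ; exact: fP.
Qed.

HB.instance Definition _ := GRing.SubZmodule_isSubLmodule.Build
  R (M -> R) smooth_pred smooth_fun smooth_subsemimod_closed.

Definition derivation_at (p : M) (v : smooth_fun -> R) : Prop :=
  (forall (a : R) (f h : smooth_fun), v (a *: f + h) = a * v f + v h) /\
  (forall f h : smooth_fun, v (f * h) = v f * h p + f p * v h).

Definition tangent_pred (p : M) : {pred (smooth_fun -> R)} :=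
  fun v => `[< derivation_at p v >].

Record tangent (p : M) := Tangent {
  tangent_val :> smooth_fun -> R; _ : tangent_val \in tangent_pred p }.

HB.instance Definition _ p := [isSub for @tangent_val p].
HB.instance Definition _ p := [Choice of tangent p by <:].

Lemma tangent_subsemimod_closed p : GRing.subsemimod_closed (tangent_pred p).
Proof.
apply: GRing.submod_closed_semi; split.
  apply/asboolP; split=> [a f h|f h] /=; first by rewrite /= mulr0 addr0.
  by rewrite mul0r mulr0 addr0.
move=> a v w /asboolP [vL vM] /asboolP [wL wM]; apply/asboolP.
have E f : (a *: v + w) f = a * v f + w f by [].
by split=> [b f h|f h]; rewrite !E (vL, vM) (wL, wM); ring.
Qed.

HB.instance Definition _ p := GRing.SubChoice_isSubLmodule.Build
  R (smooth_fun -> R) (tangent_pred p) (tangent p) (tangent_subsemimod_closed p).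

(* Vector fields are derivations X of C^oo(M). The value of X at p is the
   tangent vector f |-> X f p; thus X amounts to a section p |-> X_p such that
   p |-> X_p f is smooth for every smooth f. *)
Definition derivation (X : smooth_fun -> smooth_fun) : Prop :=
  (forall (a : R) (f h : smooth_fun), X (a *: f + h) = a *: X f + X h) /\
  (forall f h : smooth_fun, X (f * h) = X f * h + f * X h).

Definition vfield_pred : {pred (smooth_fun -> smooth_fun)} :=
  fun X => `[< derivation X >].

Record vfield := VField {
  vfield_val :> smooth_fun -> smooth_fun; _ : vfield_val \in vfield_pred }.

HB.instance Definition _ := [isSub for vfield_val].
HB.instance Definition _ := [Choice of vfield by <:].

Lemma scale_smoothE (a : R) (f h : smooth_fun) :
  (a *: f * h = a *: (f * h)) * (f * (a *: h) = a *: (f * h)).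
Proof.
split; apply: val_inj; apply/funext => p; rewrite /= !fctE /GRing.scale/=.
  by rewrite mulrA.
by rewrite mulrCA.
Qed.

Lemma vfield_subsemimod_closed : GRing.subsemimod_closed vfield_pred.
Proof.
apply: GRing.submod_closed_semi; split.
  apply/asboolP; split=> [a f h|f h] /=; first by rewrite scaler0 addr0.
  by rewrite mul0r mulr0 addr0.
move=> a X Y /asboolP [XL XM] /asboolP [YL YM]; apply/asboolP.
have E f : (a *: X + Y) f = a *: X f + Y f by [].
split=> [b f h|f h]; apply: val_inj; apply/funext => p;
  rewrite !E (XL, XM) (YL, YM) /= !fctE /GRing.scale/=; ring.
Qed.

HB.instance Definition _ := GRing.SubChoice_isSubLmodule.Build
  R (smooth_fun -> smooth_fun) vfield_pred vfield vfield_subsemimod_closed.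

Lemma vfieldP (X : vfield) : derivation X.
Proof. by case: X => X Xp; exact/asboolP. Qed.

Lemma vfield_at_subproof (X : vfield) (p : M) :
  (fun f => X f p) \in tangent_pred p.
Proof.
have [XL XM] := vfieldP X.
by apply/asboolP; split=> [a f h|f h]; rewrite ?XL ?XM.
Qed.

Definition vfield_at (X : vfield) (p : M) : tangent p :=
  Tangent (vfield_at_subproof X p).

Lemma fscale_subproof (f : smooth_fun) (X : vfield) :
  (fun h => f * X h) \in vfield_pred.
Proof.
have [XL XM] := vfieldP X; apply/asboolP; split=> [a h k|h k].
  by rewrite XL mulrDr scale_smoothE.
by rewrite XM mulrDr mulrA mulrCA.
Qed.

Definition fscale (f : smooth_fun) (X : vfield) : vfield :=
  VField (fscale_subproof f X).

Lemma bracket_subproof (X Y : vfield) :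
  (fun f => X (Y f) - Y (X f)) \in vfield_pred.
Proof.
have [XL XM] := vfieldP X; have [YL YM] := vfieldP Y.
have XD f h : X (f + h) = X f + X h by rewrite -[f]scale1r XL !scale1r.
have YD f h : Y (f + h) = Y f + Y h by rewrite -[f]scale1r YL !scale1r.
apply/asboolP; split=> [a f h|f h].
  rewrite !(XL, YL) scalerBr opprD -!addrA; congr (_ + _).
  by rewrite addrCA.
rewrite !(XM, YM, XD, YD); apply: val_inj; apply/funext => p /=.
by rewrite !fctE/=; ring.
Qed.

Definition bracket (X Y : vfield) : vfield := VField (bracket_subproof X Y).

End Manifold.

Definition is_basis (R : realType) (V : lmodType R) (k : nat) (b : 'I_k -> V) :
    Prop :=
  forall v, exists! c : 'rV[R]_k, v = \sum_i c 0 i *: b i.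

Section Geometry.
Variables (R : realType) (n : nat) (M : smoothManifoldType R n).

Record lorentz_metric := LorentzMetric {
  metric_form :> forall p : M, tangent p -> tangent p -> R;
  metric_sym : forall p (u v : tangent p), metric_form u v = metric_form v u;
  metric_linear : forall p a (u v w : tangent p),
    metric_form (a *: u + v) w = a * metric_form u w + metric_form v w;
  metric_signature : forall p, exists b : 'I_n -> tangent p, is_basis b /\
    forall i j, metric_form (b i) (b j) =
      if i == j then (if i.+1 == n then -1 else 1) else 0;
  metric_smooth : forall X Y : vfield M,
    (fun p => metric_form (vfield_at X p) (vfield_at Y p)) \in @smooth_pred R n M }.

Definition metric_eval (g : lorentz_metric) (X Y : vfield M) : smooth_fun M :=
  SmoothFun (metric_smooth g X Y).

Definition distribution := forall p : M, set (tangent p).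

Definition span_distr (s : seq (vfield M)) : distribution := fun p =>
  [set v | exists c : nat -> R, v = \sum_(i < size s) c i *: vfield_at s`_i p].

Definition sections (D : distribution) : set (vfield M) :=
  [set X | forall p, D p (vfield_at X p)].

(* Projection of vector fields onto D along D', when TM is the direct sum of D
   and D'. *)
Definition distr_proj (D D' : distribution) (X : vfield M) : vfield M :=
  xget 0 [set Y | sections D Y /\ sections D' (X - Y)].

Definition linear_connection (nabla : vfield M -> vfield M -> vfield M) : Prop :=
  [/\ (forall f X Y Z,
         nabla (fscale f X + Y) Z = fscale f (nabla X Z) + nabla Y Z),
      (forall X Y Z, nabla X (Y + Z) = nabla X Y + nabla X Z) &
      (forall f X Y,
         nabla X (fscale f Y) = fscale (X f) Y + fscale f (nabla X Y))].

Section Connection.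
Variable nabla : vfield M -> vfield M -> vfield M.

Definition torsion (X Y : vfield M) : vfield M :=
  nabla X Y - nabla Y X - bracket X Y.

Definition curvature (X Y Z : vfield M) : vfield M :=
  nabla X (nabla Y Z) - nabla Y (nabla X Z) - nabla (bracket X Y) Z.

Definition cov_deriv (omega : vfield M -> vfield M -> smooth_fun M)
    (X Y Z : vfield M) : smooth_fun M :=
  X (omega Y Z) - omega (nabla X Y) Z - omega Y (nabla X Z).

Definition quasi_statistical (omega : vfield M -> vfield M -> smooth_fun M) :
    Prop :=
  forall X Y Z,
    cov_deriv omega X Y Z - cov_deriv omega Y X Z + omega (torsion X Y) Z = 0.

Definition levi_civita (g : lorentz_metric) : Prop :=
  [/\ linear_connection nabla, forall X Y, torsion X Y = 0 &
      forall X Y Z, cov_deriv (metric_eval g) X Y Z = 0].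

(* Ricci tensor computed in a pseudo-orthonormal frame with e3 timelike. *)
Definition ricci (g : lorentz_metric) (e1 e2 e3 X Y : vfield M) : smooth_fun M :=
  - metric_eval g (curvature X e1 Y) e1 - metric_eval g (curvature X e2 Y) e2
  + metric_eval g (curvature X e3 Y) e3.

Definition sym_ricci (g : lorentz_metric) (e1 e2 e3 X Y : vfield M) :
    smooth_fun M :=
  2^-1 *: (ricci g e1 e2 e3 X Y + ricci g e1 e2 e3 Y X).

End Connection.

Definition bott_connection (nablaL : vfield M -> vfield M -> vfield M)
    (D D' : distribution) (nablaB : vfield M -> vfield M -> vfield M) : Prop :=
  linear_connection nablaB /\
  [/\ (forall X Y, sections D X -> sections D Y ->
         nablaB X Y = distr_proj D D' (nablaL X Y)),
      (forall X Y, sections D' X -> sections D Y ->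
         nablaB X Y = distr_proj D D' (bracket X Y)),
      (forall X Y, sections D X -> sections D' Y ->
         nablaB X Y = distr_proj D' D (bracket X Y)) &
      (forall X Y, sections D' X -> sections D' Y ->
         nablaB X Y = distr_proj D' D (nablaL X Y))].

End Geometry.

(* w = dF_p(v) for a smooth map F, that is, w(f) = v(f o F). Here [h] is f o F
   bundled as a smooth function, so the relation determines w only when F is
   smooth (as left translations are). *)
Definition is_pushforward (R : realType) (n m : nat) (M : smoothManifoldType R n)
    (N : smoothManifoldType R m) (F : M -> N) (p : M) (v : tangent p)
    (w : tangent (F p)) : Prop :=
  forall (f : smooth_fun N) (h : smooth_fun M),
    (forall x, h x = f (F x)) -> w f = v h.

Section LeftInvariant.
Variables (R : realType) (n : nat) (G : lieGroupType R n).

Definition ltrans (a x : G) : G := (a * x)%g.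

Definition left_invariant (X : vfield G) : Prop :=
  forall a p : G, is_pushforward (F := ltrans a) (vfield_at X p)
                                 (vfield_at X (ltrans a p)).

Definition left_invariant_metric (g : lorentz_metric G) : Prop :=
  forall (a p : G) (u v : tangent p) (u' v' : tangent (ltrans a p)),
    is_pushforward (F := ltrans a) u u' -> is_pushforward (F := ltrans a) v v' ->
    g (ltrans a p) u' v' = g p u v.

(* The Lie algebra of G is the tangent space at 1, each vector being identified
   with the left-invariant vector field it generates. *)
Definition lie_algebra_basis (k : nat) (e : 'I_k -> vfield G) : Prop :=
  (forall i, left_invariant (e i)) /\
  is_basis (fun i => vfield_at (e i) (1%g : G)).

End LeftInvariant.

(* Main.v *)
Require Import Defs.
From mathcomp Require Import all_boot all_order all_algebra.
From mathcomp Require Import ring.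
From mathcomp Require Import all_classical all_reals all_analysis.
Import Order.TTheory GRing.Theory Num.Theory.
Import numFieldNormedType.Exports.

Set Implicit Arguments.
Unset Strict Implicit.
Unset Printing Implicit Defensive.

Local Open Scope classical_set_scope.
Local Open Scope ring_scope.

(** Being quasi-statistical is a tensorial condition.  The torsion cancels the
    terms omega (nabla_X Y, Z) and leaves the Codazzi-type expression
      X (omega Y Z) - Y (omega X Z) - omega Y (nabla_X Z)
        + omega X (nabla_Y Z) - omega [X, Y] Z,
    which is linear over smooth functions in each of X, Y, Z as soon as omega
    is ([quasi_statisticalE], [codazzi_tensorial1] and the two lemmas after
    it).  The symmetrized Ricci tensor is such an omega because the curvature
    of a linear connection is a tensor ([curvature_linl], [curvature_linr]).

    On the other hand three pseudo-orthonormal vector fields form a global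
    frame: their Gram matrix is invertible and the metric is nondegenerate, so
    every vector field is a combination of them whose coefficients, being
    metric pairings, are smooth ([frame_expansion]).  The condition can
    therefore be tested on the frame alone.

    On the frame all the data are constants.  The distributions
    D = <e1, e2> and D' = <e3> are orthogonal complements, so that the
    projections are read off from metric pairings ([proj_spacelikeE],
    [proj_timelikeE]), and the parts of the Levi-Civita connection that occur
    are determined by metric compatibility and vanishing torsion
    ([levi_civita_frame]).  This makes the Bott connection explicit:
      nabla_e2 e1 = - gamma e2,  nabla_e2 e2 = gamma e1,
      nabla_e3 e1 = beta e2,  nabla_e3 e2 = - alpha e1,
      nabla_e1 e3 = - gamma e3,
    the other covariant derivatives of frame fields being 0.  The symmetrized
    Ricci tensor has, up to zeros, the components
      omega (e1, e1) = - (gamma^2 + beta^2),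
      omega (e2, e2) = - (gamma^2 + alpha beta),
      omega (e2, e3) = omega (e3, e2) = - alpha gamma / 2,
    and every Codazzi expression of frame fields is a combination of
      gamma^2 (alpha - 2 beta) / 2,  beta gamma (alpha - 2 beta) / 2  and
      alpha beta gamma / 2
    ([bott_codazzi_comb]).  All of these vanish when alpha = beta = 0; and
    since gamma is nonzero, the triples (e2, e3, e1) and (e1, e3, e3) give
    alpha = 2 beta and alpha beta = 0, hence alpha = beta = 0. *)

(** * Vector fields as a module over the smooth functions *)

Section VectorFields.
Variables (R : realType) (n : nat) (M : smoothManifoldType R n).
Implicit Types (X Y Z : vfield M) (f h k : smooth_fun M) (p : M) (a : R).

Lemma smooth_ext f h : (forall p, f p = h p) -> f = h.
Proof. by move=> fh; apply: val_inj; apply/funext => p; exact: fh. Qed.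

Lemma vfield_ext X Y : (forall f p, X f p = Y f p) -> X = Y.
Proof.
move=> XY; apply: val_inj; apply/funext => f; apply: smooth_ext => p.
exact: XY.
Qed.

Lemma vfield_at_inj X Y : (forall p, vfield_at X p = vfield_at Y p) -> X = Y.
Proof.
by move=> XY; apply: vfield_ext => f p; rewrite -[LHS]/(vfield_at X p f) XY.
Qed.

Lemma smooth_addE f h p : (f + h) p = f p + h p. Proof. by []. Qed.
Lemma smooth_oppE f p : (- f) p = - f p. Proof. by []. Qed.
Lemma smooth_mulE f h p : (f * h) p = f p * h p. Proof. by []. Qed.
Lemma smooth_scaleE a f p : (a *: f) p = a * f p. Proof. by []. Qed.
Lemma smooth_oneE p : (1 : smooth_fun M) p = 1. Proof. by []. Qed.
Lemma smooth_zeroE p : (0 : smooth_fun M) p = 0. Proof. by []. Qed.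
Definition smoothE := (smooth_addE, smooth_oppE, smooth_mulE, smooth_scaleE,
  smooth_oneE, smooth_zeroE).

Lemma vfield_addE X Y f : (X + Y) f = X f + Y f. Proof. by []. Qed.
Lemma vfield_oppE X f : (- X) f = - X f. Proof. by []. Qed.
Lemma vfield_scaleE a X f : (a *: X) f = a *: X f. Proof. by []. Qed.
Lemma vfield_fscaleE h X f : (fscale h X) f = h * X f. Proof. by []. Qed.
Lemma vfield_zeroE f : (0 : vfield M) f = 0. Proof. by []. Qed.
Lemma vfield_bracketE X Y f : bracket X Y f = X (Y f) - Y (X f).
Proof. by []. Qed.
Definition vfieldE := (vfield_addE, vfield_oppE, vfield_scaleE, vfield_fscaleE,
  vfield_zeroE, vfield_bracketE).

Lemma vfield_at_lin f X Y p :
  vfield_at (fscale f X + Y) p = f p *: vfield_at X p + vfield_at Y p.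
Proof. by apply: val_inj. Qed.

Lemma vfield_at_fscale f X p : vfield_at (fscale f X) p = f p *: vfield_at X p.
Proof. by apply: val_inj. Qed.

Lemma vfield_at_add X Y p :
  vfield_at (X + Y) p = vfield_at X p + vfield_at Y p.
Proof. by apply: val_inj. Qed.

Lemma vfieldD X f h : X (f + h) = X f + X h.
Proof. by have [XL _] := vfieldP X; rewrite -[f]scale1r XL !scale1r. Qed.

Lemma vfieldM X f h : X (f * h) = X f * h + f * X h.
Proof. by have [_ ->] := vfieldP X. Qed.

Lemma vfield0 X : X 0 = 0.
Proof. by apply: (addrI (X 0)); rewrite -vfieldD !addr0. Qed.

Lemma vfieldZ X a f : X (a *: f) = a *: X f.
Proof.
by have [XL _] := vfieldP X; rewrite -[a *: f]addr0 XL vfield0 addr0.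
Qed.

Lemma vfield1 X : X 1 = 0.
Proof.
by apply: (addrI (X 1)); rewrite addr0 -{3}[1]mulr1 vfieldM mulr1 mul1r.
Qed.

Lemma fscale1 X : fscale 1 X = X.
Proof. by apply: vfield_ext => f p; rewrite !(vfieldE, smoothE) mul1r. Qed.

Lemma fscale0 X : fscale 0 X = 0.
Proof. by apply: vfield_ext => f p; rewrite !(vfieldE, smoothE) mul0r. Qed.

Lemma fscaleN f X : fscale (- f) X = - fscale f X.
Proof. by apply: vfield_ext => h p; rewrite !(vfieldE, smoothE) mulNr. Qed.

Lemma fscale_const a X : fscale (a *: (1 : smooth_fun M)) X = a *: X.
Proof. by apply: vfield_ext => f p; rewrite !(vfieldE, smoothE) mulr1. Qed.

Lemma bracketC X Y : bracket X Y = - bracket Y X.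
Proof. by apply: vfield_ext => f p; rewrite !(vfieldE, smoothE) opprB. Qed.

Lemma bracket_lin f X X' Y : bracket (fscale f X + X') Y =
  fscale f (bracket X Y) - fscale (Y f) X + bracket X' Y.
Proof.
apply: vfield_ext => h p.
by rewrite !(vfieldE, vfieldD, vfieldM) !smoothE; ring.
Qed.

Lemma bracketxx X : bracket X X = 0.
Proof. by apply: vfield_ext => f p; rewrite !(vfieldE, smoothE) subrr. Qed.

Lemma bracketDl X X' Y : bracket (X + X') Y = bracket X Y + bracket X' Y.
Proof.
by apply: vfield_ext => h p; rewrite !(vfieldE, vfieldD) !smoothE; ring.
Qed.

Lemma bracketZl a X Y : bracket (a *: X) Y = a *: bracket X Y.
Proof.
by apply: vfield_ext => h p; rewrite !(vfieldE, vfieldZ) !smoothE; ring.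
Qed.

Lemma bracketDr X Y Y' : bracket X (Y + Y') = bracket X Y + bracket X Y'.
Proof. by rewrite bracketC bracketDl opprD -!bracketC. Qed.

Lemma bracketZr a X Y : bracket X (a *: Y) = a *: bracket X Y.
Proof. by rewrite bracketC bracketZl -scalerN -bracketC. Qed.

(** * Tensoriality of curvature and of the quasi-statistical condition *)

Definition tensorial (T : vfield M -> smooth_fun M) : Prop :=
  forall f X Y, T (fscale f X + Y) = f * T X + T Y.

Definition tensor2 (omega : vfield M -> vfield M -> smooth_fun M) : Prop :=
  (forall Y, tensorial (omega ^~ Y)) /\ (forall X, tensorial (omega X)).

Lemma tensorialD T X Y : tensorial T -> T (X + Y) = T X + T Y.
Proof. by move=> TT; rewrite -{1}[X]fscale1 TT mul1r. Qed.

Lemma tensorial0 T : tensorial T -> T 0 = 0.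
Proof. by move=> TT; apply: (addrI (T 0)); rewrite -tensorialD ?addr0. Qed.

Lemma tensorialF T f X : tensorial T -> T (fscale f X) = f * T X.
Proof. by move=> TT; rewrite -[fscale f X]addr0 TT tensorial0 ?addr0. Qed.

Lemma tensorialZ T a X : tensorial T -> T (a *: X) = a *: T X.
Proof.
move=> TT; rewrite -fscale_const tensorialF //.
by rewrite scale_smoothE mul1r.
Qed.

Lemma tensorialN T X : tensorial T -> T (- X) = - T X.
Proof. by move=> TT; rewrite -scaleN1r tensorialZ // scaleN1r. Qed.

Lemma metric_tensorial (g : lorentz_metric M) Y :
  tensorial (metric_eval g ^~ Y).
Proof.
move=> f X X'; apply: smooth_ext => p.
by rewrite /= vfield_at_lin metric_linear.
Qed.

Section Connections.
Variables (nabla : vfield M -> vfield M -> vfield M).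
Hypothesis nablaP : linear_connection nabla.

Lemma nabla_addl X Y Z : nabla (X + Y) Z = nabla X Z + nabla Y Z.
Proof.
by have [nl _ _] := nablaP; have := nl 1 X Y Z; rewrite !fscale1.
Qed.

Lemma nabla_addr X Y Z : nabla X (Y + Z) = nabla X Y + nabla X Z.
Proof. by have [_ ->] := nablaP. Qed.

Lemma nabla0l Z : nabla 0 Z = 0.
Proof. by apply: (addrI (nabla 0 Z)); rewrite -nabla_addl !addr0. Qed.

Lemma nabla_fscalel f X Z : nabla (fscale f X) Z = fscale f (nabla X Z).
Proof.
by have [nl _ _] := nablaP; rewrite -[fscale f X]addr0 nl nabla0l addr0.
Qed.

Lemma nabla_fscaler f X Y :
  nabla X (fscale f Y) = fscale (X f) Y + fscale f (nabla X Y).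
Proof. by have [_ _ ->] := nablaP. Qed.

Lemma nabla_scalel a X Z : nabla (a *: X) Z = a *: nabla X Z.
Proof. by rewrite -!fscale_const nabla_fscalel. Qed.

Lemma nabla_scaler a X Y : nabla X (a *: Y) = a *: nabla X Y.
Proof.
rewrite -!fscale_const nabla_fscaler vfieldZ vfield1 scaler0.
by apply: vfield_ext => f p; rewrite !(vfieldE, smoothE) mul0r add0r.
Qed.

Lemma nabla_oppl X Z : nabla (- X) Z = - nabla X Z.
Proof. by rewrite -scaleN1r nabla_scalel scaleN1r. Qed.

(** Differentiating [f] in [nabla Y (nabla (fscale f X) Z)] contributes
    [- (Y f) nabla X Z]; the term [- fscale (Y f) X] of the bracket of
    [fscale f X] with [Y] contributes the opposite. *)
Lemma curvature_linl f X X' Y Z : curvature nabla (fscale f X + X') Y Z =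
  fscale f (curvature nabla X Y Z) + curvature nabla X' Y Z.
Proof.
rewrite /curvature bracket_lin !(nabla_addl, nabla_oppl, nabla_fscalel).
rewrite !(nabla_addr, nabla_fscaler).
apply: vfield_ext => h p; rewrite !(vfieldE, smoothE); ring.
Qed.

Lemma curvature_linr f X Y Z Z' : curvature nabla X Y (fscale f Z + Z') =
  fscale f (curvature nabla X Y Z) + curvature nabla X Y Z'.
Proof.
rewrite /curvature !(nabla_addr, nabla_fscaler).
apply: vfield_ext => h p; rewrite !(vfieldE, smoothE); ring.
Qed.

Lemma ricci_tensor2 g u1 u2 u3 : tensor2 (ricci nabla g u1 u2 u3).
Proof.
split=> [Y f X X'|X f Y Y']; rewrite /ricci ?curvature_linl ?curvature_linr;
  rewrite !metric_tensorial;
  by apply: smooth_ext => p; rewrite !smoothE; ring.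
Qed.

Lemma sym_ricci_tensor2 g u1 u2 u3 : tensor2 (sym_ricci nabla g u1 u2 u3).
Proof.
have [rl rr] := ricci_tensor2 g u1 u2 u3.
split=> [Y f X X'|X f Y Y']; rewrite /sym_ricci rl rr;
  by apply: smooth_ext => p; rewrite !smoothE; ring.
Qed.

(** The exterior covariant derivative of [omega], viewed as a one-form with
    values in one-forms. *)
Definition codazzi omega X Y Z : smooth_fun M :=
  X (omega Y Z) - Y (omega X Z) - omega Y (nabla X Z) + omega X (nabla Y Z)
  - omega (bracket X Y) Z.

Variable omega : vfield M -> vfield M -> smooth_fun M.
Hypothesis omegaP : tensor2 omega.

(** The torsion contributes [omega (nabla X Y) Z - omega (nabla Y X) Z], exactly
    what the two covariant derivatives contain with the opposite sign; only its
    bracket survives. *)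
Lemma quasi_statisticalE :
  quasi_statistical nabla omega <-> forall X Y Z, codazzi omega X Y Z = 0.
Proof.
have [wl _] := omegaP.
suff E X Y Z : cov_deriv nabla omega X Y Z - cov_deriv nabla omega Y X Z +
    omega (torsion nabla X Y) Z = codazzi omega X Y Z.
  by split=> H X Y Z; have := H X Y Z; rewrite E.
have wD V W : omega (V + W) Z = omega V Z + omega W Z.
  exact: tensorialD (wl Z).
have wN V : omega (- V) Z = - omega V Z by exact: tensorialN (wl Z).
rewrite /cov_deriv /torsion /codazzi !(wD, wN).
by apply: smooth_ext => p; rewrite !smoothE; ring.
Qed.

Lemma codazziC X Y Z : codazzi omega X Y Z = - codazzi omega Y X Z.
Proof.
have [wl _] := omegaP; rewrite /codazzi (bracketC X Y).
rewrite (tensorialN _ (wl Z)).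
by apply: smooth_ext => p; rewrite !smoothE; ring.
Qed.

Lemma codazzi_tensorial1 Y Z : tensorial (fun X => codazzi omega X Y Z).
Proof.
have [wl wr] := omegaP => f X X'; rewrite /codazzi bracket_lin.
rewrite nabla_addl nabla_fscalel wr !wl !(tensorialD _ _ (wl Z)).
rewrite (tensorialN _ (wl Z)) !(tensorialF _ _ (wl Z)).
rewrite !(vfieldE, vfieldD, vfieldM).
by apply: smooth_ext => p; rewrite !smoothE; ring.
Qed.

Lemma codazzi_tensorial2 X Z : tensorial (fun Y => codazzi omega X Y Z).
Proof.
move=> f Y Y'; rewrite !(codazziC X) codazzi_tensorial1.
by apply: smooth_ext => p; rewrite !smoothE; ring.
Qed.

Lemma codazzi_tensorial3 X Y : tensorial (codazzi omega X Y).
Proof.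
have [wl wr] := omegaP => f Z Z'; rewrite /codazzi !wr.
rewrite !(nabla_addr, nabla_fscaler) !(tensorialD _ _ (wr _)).
rewrite !(tensorialF _ _ (wr _)) !(vfieldD, vfieldM).
by apply: smooth_ext => p; rewrite !smoothE; ring.
Qed.

End Connections.

(** * Global frames from nondegeneracy of the metric *)

Section Metric.
Variable g : lorentz_metric M.

Lemma metric_evalE X Y p :
  metric_eval g X Y p = g p (vfield_at X p) (vfield_at Y p).
Proof. by []. Qed.

Lemma metric_evalC X Y : metric_eval g X Y = metric_eval g Y X.
Proof. by apply: smooth_ext => p; rewrite !metric_evalE Defs.metric_sym. Qed.

Lemma metric_form_sum p (I : Type) (r : seq I) (c : I -> R)
    (b : I -> tangent p) (u : tangent p) :
  g p (\sum_(i <- r) c i *: b i) u = \sum_(i <- r) c i * g p (b i) u.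
Proof.
have g0 : g p 0 u = 0.
  rewrite -[0 in LHS](addNr (0 : tangent p)) -scaleN1r.
  by rewrite metric_linear mulN1r addNr.
elim: r => [|i r IH]; first by rewrite !big_nil.
by rewrite !big_cons metric_linear IH.
Qed.

(** Let [J] be the Gram matrix of a basis of the tangent space and [A] the
    matrix of [e] in that basis.  The Gram matrix of [e] is [A J A^T], so
    [J A^T] is invertible; it maps the coordinates of [v] to its pairings with
    [e]. *)
Lemma metric_nondegenerate p (e : 'I_n -> tangent p) (v : tangent p) :
  (\matrix_(i, j) g p (e i) (e j)) \in unitmx ->
  (forall i, g p v (e i) = 0) -> v = 0.
Proof.
move=> Gu ve0; have [b [bB bo]] := metric_signature g p.
pose J : 'M[R]_n := \matrix_(i, j) g p (b i) (b j).
have coordE (w : tangent p) : exists c : 'rV_n, w = \sum_i c 0 i *: b i.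
  by have [c [-> _]] := bB w; exists c.
have [A AE] : exists A : 'M[R]_n, forall i, e i = \sum_j A i j *: b j.
  have [c cE] := choice (fun i => coordE (e i)).
  exists (\matrix_(i, j) c i 0 j) => i; rewrite {1}cE.
  by apply: eq_bigr => j _; rewrite mxE.
have pairE (w : tangent p) (c : 'rV[R]_n) i : w = \sum_i c 0 i *: b i ->
    g p w (e i) = (c *m (J *m A^T)) 0 i.
  move=> ->; rewrite metric_form_sum mxE; apply: eq_bigr => j _; congr (_ * _).
  rewrite Defs.metric_sym AE metric_form_sum mxE; apply: eq_bigr => k _.
  by rewrite !mxE mulrC Defs.metric_sym.
have GE : \matrix_(i, j) g p (e i) (e j) = A *m (J *m A^T).
  apply/matrixP => i j; rewrite mxE (pairE _ (row i A)); last first.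
    by rewrite AE; apply: eq_bigr => k _; rewrite mxE.
  by rewrite -row_mul mxE.
have [c cE] := coordE v.
have c0 : c *m (J *m A^T) = 0.
  by apply/rowP => i; rewrite -(pairE v) // ve0 mxE.
have JAu : J *m A^T \in unitmx by move: Gu; rewrite GE unitmx_mul => /andP[].
have {}c0 : c = 0 by rewrite -(mulmxK JAu c) c0 mul0mx.
by rewrite cE c0 big1 // => i _; rewrite mxE scale0r.
Qed.

Lemma metricD X Y Z :
  metric_eval g (X + Y) Z = metric_eval g X Z + metric_eval g Y Z.
Proof. exact: tensorialD (metric_tensorial g Z). Qed.
Lemma metricF f X Z : metric_eval g (fscale f X) Z = f * metric_eval g X Z.
Proof. exact: tensorialF (metric_tensorial g Z). Qed.
Lemma metricZ a X Z : metric_eval g (a *: X) Z = a *: metric_eval g X Z.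
Proof. exact: tensorialZ (metric_tensorial g Z). Qed.
Lemma metricN X Z : metric_eval g (- X) Z = - metric_eval g X Z.
Proof. exact: tensorialN (metric_tensorial g Z). Qed.
Definition metricE := (metricD, metricF, metricZ, metricN).

End Metric.
End VectorFields.

(** * The Levi-Civita connection on fields with constant pairings *)

Section LeviCivita.
Variables (R : realType) (n : nat) (M : smoothManifoldType R n).
Variables (g : lorentz_metric M) (nablaL : vfield M -> vfield M -> vfield M).
Hypothesis hL : levi_civita nablaL g.
Implicit Types X Y Z : vfield M.

(** Constant pairings have zero derivative, so metric compatibility says that
    [nablaL X] acts on such fields as an infinitesimal isometry. *)
Lemma levi_civita_skew X Y Z (a : R) :
  metric_eval g Y Z = a *: (1 : smooth_fun M) ->
  metric_eval g (nablaL X Y) Z = - metric_eval g (nablaL X Z) Y.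
Proof.
have [_ _ hM] := hL => YZ; have := hM X Y Z; rewrite /cov_deriv YZ.
rewrite vfieldZ vfield1 scaler0 add0r (metric_evalC g Y) => /eqP.
by rewrite subr_eq0 => /eqP <-; rewrite opprK.
Qed.

Lemma levi_civita_skew0 X Y (a : R) :
  metric_eval g Y Y = a *: (1 : smooth_fun M) ->
  metric_eval g (nablaL X Y) Y = 0.
Proof.
move=> /levi_civita_skew -/(_ X) E; apply: smooth_ext => p.
move/(congr1 (fun f : smooth_fun M => f p)): E; rewrite smoothE => /eqP.
by rewrite -addr_eq0 -mulr2n mulrn_eq0 => /eqP.
Qed.

Lemma levi_civita_torsion X Y Z : metric_eval g (nablaL X Y) Z =
  metric_eval g (nablaL Y X) Z + metric_eval g (bracket X Y) Z.
Proof.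
have [_ hT _] := hL; rewrite -metricD; congr (metric_eval g _ Z).
by have /subr0_eq/eqP := hT X Y; rewrite subr_eq addrC => /eqP.
Qed.

End LeviCivita.

(** * Bilinear operations on constant combinations of three vectors *)

Section Combinations.
Variables (R : comNzRingType) (V : lmodType R) (x1 x2 x3 : V).

Definition comb3 (a b c : R) : V := a *: x1 + b *: x2 + c *: x3.

Lemma comb3_eq a b c a' b' c' :
  a = a' -> b = b' -> c = c' -> comb3 a b c = comb3 a' b' c'.
Proof. by move=> -> -> ->. Qed.

Lemma comb3_0 : comb3 0 0 0 = 0.
Proof. by rewrite /comb3 !scale0r !addr0. Qed.

Lemma comb3_1 : comb3 1 0 0 = x1.
Proof. by rewrite /comb3 !scale0r !addr0 scale1r. Qed.

Lemma comb3_2 : comb3 0 1 0 = x2.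
Proof. by rewrite /comb3 !scale0r addr0 add0r scale1r. Qed.

Lemma comb3_3 : comb3 0 0 1 = x3.
Proof. by rewrite /comb3 !scale0r !add0r scale1r. Qed.

Lemma comb3Z r a b c : r *: comb3 a b c = comb3 (r * a) (r * b) (r * c).
Proof. by rewrite /comb3 !scalerDr !scalerA. Qed.

Lemma comb3D a1 a2 a3 b1 b2 b3 :
  comb3 a1 a2 a3 + comb3 b1 b2 b3 = comb3 (a1 + b1) (a2 + b2) (a3 + b3).
Proof. by rewrite /comb3 !scalerDl addrACA [X in X + _]addrACA. Qed.

Lemma comb3B a1 a2 a3 b1 b2 b3 :
  comb3 a1 a2 a3 - comb3 b1 b2 b3 = comb3 (a1 - b1) (a2 - b2) (a3 - b3).
Proof. by rewrite -scaleN1r comb3Z comb3D !mulN1r. Qed.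

Lemma comb3BB_eq a1 a2 a3 b1 b2 b3 c1 c2 c3 d1 d2 d3 :
  a1 - b1 - c1 = d1 -> a2 - b2 - c2 = d2 -> a3 - b3 - c3 = d3 ->
  comb3 a1 a2 a3 - comb3 b1 b2 b3 - comb3 c1 c2 c3 = comb3 d1 d2 d3.
Proof. by move=> <- <- <-; rewrite !comb3B. Qed.

Lemma linear_comb3 (f : V -> V) u1 u2 u3 v1 v2 v3 w1 w2 w3 a b c :
  (forall u v, f (u + v) = f u + f v) -> (forall r u, f (r *: u) = r *: f u) ->
  f x1 = comb3 u1 u2 u3 -> f x2 = comb3 v1 v2 v3 -> f x3 = comb3 w1 w2 w3 ->
  f (comb3 a b c) = comb3 (a * u1 + b * v1 + c * w1)
    (a * u2 + b * v2 + c * w2) (a * u3 + b * v3 + c * w3).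
Proof.
move=> fD fZ f1 f2 f3.
by rewrite {1}/comb3 !fD !fZ f1 f2 f3 !comb3Z !comb3D.
Qed.

(** The triple [pij, qij, rij] holds the structure constants of [B] on the pair
    [xi, xj]; both the bracket and the Bott connection are of this form on
    fields with constant coefficients. *)
Lemma bilinear_comb3 (B : V -> V -> V)
    p11 p12 p13 p21 p22 p23 p31 p32 p33
    q11 q12 q13 q21 q22 q23 q31 q32 q33
    r11 r12 r13 r21 r22 r23 r31 r32 r33
    a1 a2 a3 b1 b2 b3 :
  (forall u v w, B (u + v) w = B u w + B v w) ->
  (forall r u w, B (r *: u) w = r *: B u w) ->
  (forall u v w, B u (v + w) = B u v + B u w) ->
  (forall r u w, B u (r *: w) = r *: B u w) ->
  B x1 x1 = comb3 p11 q11 r11 -> B x1 x2 = comb3 p12 q12 r12 ->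
  B x1 x3 = comb3 p13 q13 r13 ->
  B x2 x1 = comb3 p21 q21 r21 -> B x2 x2 = comb3 p22 q22 r22 ->
  B x2 x3 = comb3 p23 q23 r23 ->
  B x3 x1 = comb3 p31 q31 r31 -> B x3 x2 = comb3 p32 q32 r32 ->
  B x3 x3 = comb3 p33 q33 r33 ->
  B (comb3 a1 a2 a3) (comb3 b1 b2 b3) = comb3
    (a1 * (b1 * p11 + b2 * p12 + b3 * p13)
     + a2 * (b1 * p21 + b2 * p22 + b3 * p23)
     + a3 * (b1 * p31 + b2 * p32 + b3 * p33))
    (a1 * (b1 * q11 + b2 * q12 + b3 * q13)
     + a2 * (b1 * q21 + b2 * q22 + b3 * q23)
     + a3 * (b1 * q31 + b2 * q32 + b3 * q33))
    (a1 * (b1 * r11 + b2 * r12 + b3 * r13)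
     + a2 * (b1 * r21 + b2 * r22 + b3 * r23)
     + a3 * (b1 * r31 + b2 * r32 + b3 * r33)).
Proof.
move=> BDl BZl BDr BZr B11 B12 B13 B21 B22 B23 B31 B32 B33.
have Br u := linear_comb3 b1 b2 b3 (BDr u) (fun r v => BZr r u v).
exact: (linear_comb3 a1 a2 a3 (fun u v => BDl u v _) (fun r u => BZl r u _)
  (Br _ _ _ _ _ _ _ _ _ _ B11 B12 B13) (Br _ _ _ _ _ _ _ _ _ _ B21 B22 B23)
  (Br _ _ _ _ _ _ _ _ _ _ B31 B32 B33)).
Qed.

End Combinations.

(** * Pseudo-orthonormal frames of Lorentzian three-manifolds *)

Section LorentzFrame.
Variables (R : realType) (M : smoothManifoldType R 3) (g : lorentz_metric M).
Variables e1 e2 e3 : vfield M.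
Hypothesis g11 : metric_eval g e1 e1 = 1.
Hypothesis g22 : metric_eval g e2 e2 = 1.
Hypothesis g33 : metric_eval g e3 e3 = -1.
Hypothesis g12 : metric_eval g e1 e2 = 0.
Hypothesis g13 : metric_eval g e1 e3 = 0.
Hypothesis g23 : metric_eval g e2 e3 = 0.
Implicit Types (X Y Z : vfield M) (f h k : smooth_fun M) (p : M) (a : R).

Local Notation scalar a := (a *: (1 : smooth_fun M)).

Local Notation comb := (comb3 e1 e2 e3).

Let g21 : metric_eval g e2 e1 = 0. Proof. by rewrite metric_evalC. Qed.
Let g31 : metric_eval g e3 e1 = 0. Proof. by rewrite metric_evalC. Qed.
Let g32 : metric_eval g e3 e2 = 0. Proof. by rewrite metric_evalC. Qed.
Let gramE := (g11, g22, g33, g12, g13, g23, g21, g31, g32).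

(** The Gram matrix is the sign matrix diag(1, 1, -1), its own inverse. *)
Lemma frame_gram_unit p :
  \matrix_(i, j) g p (vfield_at (tnth [tuple e1; e2; e3] i) p)
                     (vfield_at (tnth [tuple e1; e2; e3] j) p) \in unitmx.
Proof.
set G := \matrix_(_, _) _.
suff GG : G *m G = 1%:M by case: (mulmx1_unit GG).
have GE : G = \matrix_(i, j) ((i == j)%:R * (-1) ^+ (i == 2%N :> nat)).
  apply/matrixP => i j; rewrite !mxE -metric_evalE.
  suff -> : metric_eval g (tnth [tuple e1; e2; e3] i)
      (tnth [tuple e1; e2; e3] j) =
      scalar ((i == j)%:R * (-1) ^+ (i == 2%N :> nat)).
    by rewrite !smoothE mulr1.
  by case: i => [[|[|[|//]]] ?]; case: j => [[|[|[|//]]] ?];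
    rewrite !(tnth_nth e1) /= gramE /= ?mul1r ?mul0r ?expr0 ?expr1
            ?scale1r ?scale0r ?scaleN1r.
rewrite GE; apply/matrixP => i j; rewrite !mxE (bigD1 i) //= big1.
  by rewrite !mxE eqxx mul1r addr0 mulrCA -expr2 sqrr_sign mulr1.
by move=> k ki; rewrite !mxE eq_sym (negbTE ki) !mul0r.
Qed.

(** By nondegeneracy a vector field is determined by its pairings with the
    frame; identities between projections are proved in this way. *)
Lemma frame_ext X Y :
  metric_eval g X e1 = metric_eval g Y e1 ->
  metric_eval g X e2 = metric_eval g Y e2 ->
  metric_eval g X e3 = metric_eval g Y e3 -> X = Y.
Proof.
move=> E1 E2 E3; apply/eqP; rewrite -subr_eq0; apply/eqP.
apply: vfield_at_inj => p.
transitivity (0 : tangent p); last exact: val_inj.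
apply: metric_nondegenerate (frame_gram_unit p) _.
move=> i; rewrite -metric_evalE.
suff -> : metric_eval g (X - Y) (tnth [tuple e1; e2; e3] i) = 0 by [].
rewrite metricD metricN.
by case: i => [[|[|[|//]]] ?]; rewrite (tnth_nth e1) /= ?E1 ?E2 ?E3 subrr.
Qed.

Lemma frame_expansion X : X = fscale (metric_eval g X e1) e1 +
  fscale (metric_eval g X e2) e2 + fscale (- metric_eval g X e3) e3.
Proof.
by apply: frame_ext; rewrite !metricE !gramE; apply: smooth_ext => p;
  rewrite !smoothE; ring.
Qed.

(** Constant coefficients suffice, because a tensorial map sees the variable
    coefficients of [frame_expansion] only as factors. *)
Lemma tensorial_eq0 (T : vfield M -> smooth_fun M) :
  tensorial T -> (forall a b c, T (comb a b c) = 0) -> forall X, T X = 0.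
Proof.
move=> TT T0 X; rewrite (frame_expansion X).
have T1 := T0 1 0 0; have T2 := T0 0 1 0; have T3 := T0 0 0 1.
rewrite comb3_1 in T1; rewrite comb3_2 in T2; rewrite comb3_3 in T3.
rewrite !(tensorialD _ _ TT) !(tensorialF _ _ TT) T1 T2 T3.
by rewrite !mulr0 !addr0.
Qed.

Lemma tensorial3_eq0 (T : vfield M -> vfield M -> vfield M -> smooth_fun M) :
  (forall Y Z, tensorial (fun X => T X Y Z)) ->
  (forall X Z, tensorial (fun Y => T X Y Z)) ->
  (forall X Y, tensorial (T X Y)) ->
  (forall a1 a2 a3 b1 b2 b3 c1 c2 c3,
     T (comb a1 a2 a3) (comb b1 b2 b3) (comb c1 c2 c3) = 0) ->
  forall X Y Z, T X Y Z = 0.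
Proof.
move=> T1 T2 T3 T0 X Y Z.
apply: (tensorial_eq0 (T1 Y Z)) => a1 a2 a3.
apply: (tensorial_eq0 (T2 _ Z)) => b1 b2 b3.
by apply: (tensorial_eq0 (T3 _ _)) => c1 c2 c3.
Qed.

(** Pairings with the frame decide membership in the two distributions, which
    are each other's orthogonal complement. *)
Lemma sections_spacelikeP X :
  sections (span_distr [:: e1; e2]) X <-> metric_eval g X e3 = 0.
Proof.
split=> [DX|X3 p].
  apply: smooth_ext => p; have [c cE] := DX p.
  rewrite metric_evalE cE metric_form_sum !big_ord_recl big_ord0 /=.
  by rewrite -!metric_evalE g13 g23 /= !mulr0 !addr0.
exists (fun i =>
  if i == 0%N then metric_eval g X e1 p else metric_eval g X e2 p).
rewrite !big_ord_recl big_ord0 addr0 [in LHS](frame_expansion X) X3 oppr0.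
by rewrite !(vfield_at_add, vfield_at_fscale) scale0r addr0.
Qed.

Lemma sections_timelikeP X : sections (span_distr [:: e3]) X <->
  metric_eval g X e1 = 0 /\ metric_eval g X e2 = 0.
Proof.
split=> [DX|[X1 X2] p].
  have XE i p : g p (vfield_at e3 p) (vfield_at i p) = 0 ->
      metric_eval g X i p = 0.
    move=> e3i; have [c cE] := DX p.
    rewrite metric_evalE cE metric_form_sum !big_ord_recl big_ord0 /=.
    by rewrite e3i mulr0 addr0.
  by split; apply: smooth_ext => p; apply: XE; rewrite -metric_evalE gramE.
exists (fun=> - metric_eval g X e3 p).
rewrite !big_ord_recl big_ord0 addr0 [in LHS](frame_expansion X) X1 X2.
by rewrite !(vfield_at_add, vfield_at_fscale) !scale0r !add0r.
Qed.

(** Uniqueness, which makes the choice in [distr_proj] harmless, holds because a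
    field in both distributions pairs to 0 with the whole frame. *)
Lemma proj_spacelikeE X :
  distr_proj (span_distr [:: e1; e2]) (span_distr [:: e3]) X =
  fscale (metric_eval g X e1) e1 + fscale (metric_eval g X e2) e2.
Proof.
apply: xget_unique => [|Y [/sections_spacelikeP Y3 /sections_timelikeP]].
  split; [apply/sections_spacelikeP | apply/sections_timelikeP; split];
    rewrite !metricE !gramE; apply: smooth_ext => p; rewrite !smoothE; ring.
rewrite !metricE => -[/subr0_eq X1 /subr0_eq X2].
by apply: frame_ext; rewrite !metricE !gramE ?X1 ?X2 ?Y3
  ?(mulr0, mulr1, addr0, add0r).
Qed.

Lemma proj_timelikeE X :
  distr_proj (span_distr [:: e3]) (span_distr [:: e1; e2]) X =
  fscale (- metric_eval g X e3) e3.
Proof.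
apply: xget_unique => [|Y [/sections_timelikeP[Y1 Y2] /sections_spacelikeP]].
  split; [apply/sections_timelikeP; split | apply/sections_spacelikeP];
    rewrite !metricE !gramE; apply: smooth_ext => p; rewrite !smoothE; ring.
rewrite !metricE => /subr0_eq X3.
by apply: frame_ext; rewrite !metricE !gramE ?X3 ?Y1 ?Y2
  ?(mulr0, mulrNN, mulr1).
Qed.

(** * The Bott connection and its Ricci tensor on the frame *)

Section StructureConstants.
Variables alpha beta gamma : R.
Hypothesis h12 : bracket e1 e2 = gamma *: e2 - beta *: e3.
Hypothesis h13 : bracket e1 e3 = - (beta *: e2) - gamma *: e3.
Hypothesis h23 : bracket e2 e3 = alpha *: e1.

Lemma bracket_comb a1 a2 a3 b1 b2 b3 :
  bracket (comb a1 a2 a3) (comb b1 b2 b3) =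
  comb (alpha * (a2 * b3 - a3 * b2))
       (gamma * (a1 * b2 - a2 * b1) - beta * (a1 * b3 - a3 * b1))
       (- beta * (a1 * b2 - a2 * b1) - gamma * (a1 * b3 - a3 * b1)).
Proof.
have h21 : bracket e2 e1 = comb 0 (- gamma) beta.
  by rewrite bracketC h12 /comb3 scale0r add0r opprB addrC scaleNr.
have h31 : bracket e3 e1 = comb 0 beta gamma.
  by rewrite bracketC h13 /comb3 scale0r add0r opprB opprK addrC.
have h32 : bracket e3 e2 = comb (- alpha) 0 0.
  by rewrite bracketC h23 /comb3 !scale0r !addr0 scaleNr.
have h12' : bracket e1 e2 = comb 0 gamma (- beta).
  by rewrite h12 /comb3 scale0r add0r scaleNr.
have h13' : bracket e1 e3 = comb 0 (- beta) (- gamma).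
  by rewrite h13 /comb3 scale0r add0r !scaleNr.
have h23' : bracket e2 e3 = comb alpha 0 0.
  by rewrite h23 /comb3 !scale0r !addr0.
have h0 X : bracket X X = comb 0 0 0 by rewrite bracketxx comb3_0.
rewrite (bilinear_comb3 (B := @bracket R 3 M) a1 a2 a3 b1 b2 b3
  (@bracketDl R 3 M) (@bracketZl R 3 M) (@bracketDr R 3 M) (@bracketZr R 3 M)
  (h0 e1) h12' h13' h21 (h0 e2) h23' h31 h32 (h0 e3)).
by apply: comb3_eq; ring.
Qed.

Lemma metric_comb a1 a2 a3 b1 b2 b3 :
  metric_eval g (comb a1 a2 a3) (comb b1 b2 b3) =
  scalar (a1 * b1 + a2 * b2 - a3 * b3).
Proof.
rewrite /comb3 !(metricD, metricZ).
rewrite !(metric_evalC g _ (_ + _)) !(metricD, metricZ) !gramE.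
by apply: smooth_ext => p; rewrite !smoothE; ring.
Qed.

Section Bott.
Variables nablaL nablaB : vfield M -> vfield M -> vfield M.
Hypothesis hL : levi_civita nablaL g.
Hypothesis hB : bott_connection nablaL (span_distr [:: e1; e2])
  (span_distr [:: e3]) nablaB.

Let De1 : sections (span_distr [:: e1; e2]) e1.
Proof. exact/sections_spacelikeP. Qed.
Let De2 : sections (span_distr [:: e1; e2]) e2.
Proof. exact/sections_spacelikeP. Qed.
Let De3 : sections (span_distr [:: e3]) e3.
Proof. exact/sections_timelikeP. Qed.

Let skew11 X : metric_eval g (nablaL X e1) e1 = 0.
Proof. by apply: (levi_civita_skew0 hL X (a := 1)); rewrite g11 scale1r. Qed.
Let skew22 X : metric_eval g (nablaL X e2) e2 = 0.
Proof. by apply: (levi_civita_skew0 hL X (a := 1)); rewrite g22 scale1r. Qed.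
Let skew33 X : metric_eval g (nablaL X e3) e3 = 0.
Proof. by apply: (levi_civita_skew0 hL X (a := -1)); rewrite g33 scaleN1r. Qed.
Let skew12 X :
  metric_eval g (nablaL X e1) e2 = - metric_eval g (nablaL X e2) e1.
Proof. by apply: (levi_civita_skew hL X (a := 0)); rewrite g12 scale0r. Qed.

(** These components suffice: in the Bott connection the Levi-Civita connection
    only enters through the D-part of [nablaL X Y] for X, Y in D and through
    [nablaL e3 e3], whose pairing with [e3] is 0. *)
Lemma levi_civita_frame :
  [/\ metric_eval g (nablaL e1 e1) e2 = 0,
      metric_eval g (nablaL e1 e2) e1 = 0,
      metric_eval g (nablaL e2 e1) e2 = scalar (- gamma) &
      metric_eval g (nablaL e2 e2) e1 = scalar gamma].
Proof.
have [b121 b122] : metric_eval g (bracket e1 e2) e1 = 0 /\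
    metric_eval g (bracket e1 e2) e2 = scalar gamma.
  rewrite h12 !metricE !gramE.
  by split; apply: smooth_ext => p; rewrite !smoothE; ring.
have L121 : metric_eval g (nablaL e1 e2) e1 = 0.
  by rewrite (levi_civita_torsion hL) b121 skew11 addr0.
have L212 : metric_eval g (nablaL e2 e1) e2 = scalar (- gamma).
  rewrite -[LHS](addrK (metric_eval g (bracket e1 e2) e2)).
  by rewrite -(levi_civita_torsion hL) skew22 b122 add0r scaleNr.
split=> //; first by rewrite skew12 L121 oppr0.
by rewrite -[LHS]opprK -skew12 L212 scaleNr opprK.
Qed.

(** The two distributions are differentiated along themselves by the projected
    Levi-Civita connection and along each other by the projected bracket. *)
Lemma bott_frame :
  (nablaB e1 e1 = comb 0 0 0) * (nablaB e1 e2 = comb 0 0 0) *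
  (nablaB e1 e3 = comb 0 0 (- gamma)) *
  (nablaB e2 e1 = comb 0 (- gamma) 0) * (nablaB e2 e2 = comb gamma 0 0) *
  (nablaB e2 e3 = comb 0 0 0) *
  (nablaB e3 e1 = comb 0 beta 0) * (nablaB e3 e2 = comb (- alpha) 0 0) *
  (nablaB e3 e3 = comb 0 0 0).
Proof.
have [_ [DD D'D DD' D'D']] := hB.
have [L112 L121 L212 L221] := levi_civita_frame.
rewrite !comb3_0.
have c1 a : comb a 0 0 = a *: e1 by rewrite /comb3 !scale0r !addr0.
have c2 a : comb 0 a 0 = a *: e2 by rewrite /comb3 !scale0r addr0 add0r.
have c3 a : comb 0 0 a = a *: e3 by rewrite /comb3 !scale0r !add0r.
rewrite !c1 !c2 !c3.
do !split.
- by rewrite DD // proj_spacelikeE skew11 L112 !fscale0 addr0.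
- by rewrite DD // proj_spacelikeE L121 skew22 !fscale0 addr0.
- rewrite DD' // proj_timelikeE h13 !metricE !gramE.
  by rewrite scaler0 oppr0 sub0r scalerN opprK fscaleN fscale_const scaleNr.
- by rewrite DD // proj_spacelikeE skew11 L212 fscale0 add0r fscale_const.
- by rewrite DD // proj_spacelikeE L221 skew22 fscale0 addr0 fscale_const.
- by rewrite DD' // proj_timelikeE h23 !metricE !gramE scaler0 oppr0 fscale0.
- rewrite D'D // proj_spacelikeE bracketC h13 !metricE !gramE.
  rewrite !scaler0 !oppr0 !addr0 oppr0 fscale0 add0r opprK.
  by rewrite fscale_const.
- rewrite D'D // proj_spacelikeE bracketC h23 !metricE !gramE.
  by rewrite scaler0 oppr0 fscale0 addr0 -scaleNr fscale_const.
- by rewrite D'D' // proj_timelikeE skew33 oppr0 fscale0.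
Qed.

Let nablaP : linear_connection nablaB. Proof. by case: hB. Qed.

Lemma bott_comb a1 a2 a3 b1 b2 b3 :
  nablaB (comb a1 a2 a3) (comb b1 b2 b3) =
  comb (gamma * a2 * b2 - alpha * a3 * b2)
       (beta * a3 * b1 - gamma * a2 * b1) (- gamma * a1 * b3).
Proof.
have [[[[[[[[n11 n12] n13] n21] n22] n23] n31] n32] n33] := bott_frame.
rewrite (bilinear_comb3 (B := nablaB) a1 a2 a3 b1 b2 b3 (nabla_addl nablaP)
  (nabla_scalel nablaP) (nabla_addr nablaP) (nabla_scaler nablaP)
  n11 n12 n13 n21 n22 n23 n31 n32 n33).
by apply: comb3_eq; ring.
Qed.

(** The curvature is alternating in its first two arguments, hence the minors
    [d12], [d13], [d23]; it preserves both distributions because the connection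
    does. *)
Lemma bott_curvature_comb a1 a2 a3 b1 b2 b3 c1 c2 c3 :
  let d12 := a1 * b2 - a2 * b1 in
  let d13 := a1 * b3 - a3 * b1 in
  let d23 := a2 * b3 - a3 * b2 in
  curvature nablaB (comb a1 a2 a3) (comb b1 b2 b3) (comb c1 c2 c3) =
  comb (- (gamma ^+ 2 + alpha * beta) * d12 * c2
        + gamma * (beta - alpha) * (d13 * c2 + d23 * c1))
       ((gamma ^+ 2 + beta ^+ 2) * d12 * c1 - gamma * (beta - alpha) * d23 * c2)
       (alpha * gamma * d23 * c3).
Proof.
move=> d12 d13 d23; rewrite /curvature bracket_comb !bott_comb.
by apply: comb3BB_eq; rewrite /d12 /d13 /d23; ring.
Qed.

Lemma bott_ricci_comb a1 a2 a3 b1 b2 b3 :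
  ricci nablaB g e1 e2 e3 (comb a1 a2 a3) (comb b1 b2 b3) =
  scalar (- (gamma ^+ 2 + beta ^+ 2) * a1 * b1
          - (gamma ^+ 2 + alpha * beta) * a2 * b2 - alpha * gamma * a2 * b3).
Proof.
(* Frame fields are expressed as combinations so that the curvature formula
   applies. *)
transitivity (ricci nablaB g (comb 1 0 0) (comb 0 1 0) (comb 0 0 1)
  (comb a1 a2 a3) (comb b1 b2 b3)); first by rewrite comb3_1 comb3_2 comb3_3.
rewrite /ricci !bott_curvature_comb !metric_comb.
by apply: smooth_ext => p; rewrite !smoothE; ring.
Qed.

Let omega := sym_ricci nablaB g e1 e2 e3.

Lemma bott_sym_ricci_comb a1 a2 a3 b1 b2 b3 :
  omega (comb a1 a2 a3) (comb b1 b2 b3) =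
  scalar (- (gamma ^+ 2 + beta ^+ 2) * a1 * b1
          - (gamma ^+ 2 + alpha * beta) * a2 * b2
          - 2^-1 * alpha * gamma * (a2 * b3 + a3 * b2)).
Proof.
rewrite /omega /sym_ricci !bott_ricci_comb.
by apply: smooth_ext => p; rewrite !smoothE; field.
Qed.

(** On constant combinations [omega] is constant, so its two derivatives
    vanish and the rest is polynomial in the coefficients. *)
Lemma bott_codazzi_comb a1 a2 a3 b1 b2 b3 c1 c2 c3 :
  codazzi nablaB omega (comb a1 a2 a3) (comb b1 b2 b3) (comb c1 c2 c3) =
  scalar ((a1 * b2 - a2 * b1) * c2 * (2^-1 * beta * gamma * (alpha - 2 * beta))
    - (a1 * b3 - a3 * b1) * c3 * (2^-1 * alpha * beta * gamma)
    + ((a1 * b3 - a3 * b1) * c2 + (a2 * b3 - a3 * b2) * c1) *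
      (2^-1 * gamma ^+ 2 * (alpha - 2 * beta))).
Proof.
rewrite /codazzi !bott_comb bracket_comb !bott_sym_ricci_comb.
rewrite !vfieldZ !vfield1.
by apply: smooth_ext => p; rewrite !smoothE; field.
Qed.

End Bott.
End StructureConstants.
End LorentzFrame.

Theorem theorem3p3 (R : realType) (alpha beta gamma : R) (hgamma : gamma != 0)
  (G : lieGroupType R 3)
  (hconnected : connected [set: G]) (hsimply : simply_connected R G)
  (g : lorentz_metric G) (hg : left_invariant_metric g)
  (e1 e2 e3 : vfield G)
  (hbasis : lie_algebra_basis (tnth [tuple e1; e2; e3]))
  (g11 : metric_eval g e1 e1 = 1) (g22 : metric_eval g e2 e2 = 1)
  (g33 : metric_eval g e3 e3 = -1)
  (g12 : metric_eval g e1 e2 = 0) (g13 : metric_eval g e1 e3 = 0)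
  (g23 : metric_eval g e2 e3 = 0)
  (h12 : bracket e1 e2 = gamma *: e2 - beta *: e3)
  (h13 : bracket e1 e3 = - (beta *: e2) - gamma *: e3)
  (h23 : bracket e2 e3 = alpha *: e1)
  (nablaL : vfield G -> vfield G -> vfield G) (hL : levi_civita nablaL g)
  (nablaB : vfield G -> vfield G -> vfield G)
  (hB : bott_connection nablaL (span_distr [:: e1; e2]) (span_distr [:: e3])
                        nablaB) :
  quasi_statistical nablaB (sym_ricci nablaB g e1 e2 e3) <->
  [/\ alpha = 0, beta = 0 & gamma != 0].
Proof.
have nablaP : linear_connection nablaB by case: hB.
have Q := quasi_statisticalE nablaB (sym_ricci_tensor2 nablaP g e1 e2 e3).
have codazziE := bott_codazzi_comb g11 g22 g33 g12 g13 g23 h12 h13 h23 hL hB.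
have scalar_eq0 (a : R) : a *: (1 : smooth_fun G) = 0 -> a = 0.
  move=> /(congr1 (fun f : smooth_fun G => f (1%g : G))).
  by rewrite !smoothE mulr1.
split=> [/Q C0|[alpha0 beta0 _]].
  (* The triple (e2, e3, e1) isolates gamma^2 (alpha - 2 beta), and
     (e1, e3, e3) isolates alpha beta gamma. *)
  have := C0 (comb3 e1 e2 e3 0 1 0) (comb3 e1 e2 e3 0 0 1)
    (comb3 e1 e2 e3 1 0 0).
  rewrite codazziE => /scalar_eq0 C231.
  have := C0 (comb3 e1 e2 e3 1 0 0) (comb3 e1 e2 e3 0 0 1)
    (comb3 e1 e2 e3 0 0 1).
  rewrite codazziE => /scalar_eq0 C133.
  have alphaE : alpha = 2 * beta.
    apply/eqP; rewrite -subr_eq0.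
    have : 2^-1 * gamma ^+ 2 * (alpha - 2 * beta) = 0 by rewrite -C231; ring.
    by move=> /eqP; rewrite !mulf_eq0 invr_eq0 pnatr_eq0 /= (negbTE hgamma).
  have beta0 : beta = 0.
    have : gamma * beta ^+ 2 = 0 by rewrite -[RHS]oppr0 -C133 alphaE; field.
    move=> /eqP; rewrite mulf_eq0 (negbTE hgamma) /=.
    by rewrite expf_eq0 /= => /eqP.
  by rewrite alphaE beta0 mulr0.
apply/Q; apply: (tensorial3_eq0 g11 g22 g33 g12 g13 g23) => //.
- by move=> Y Z; apply: codazzi_tensorial1 => //; exact: sym_ricci_tensor2.
- by move=> X Z; apply: codazzi_tensorial2 => //; exact: sym_ricci_tensor2.
- by move=> X Y; apply: codazzi_tensorial3 => //; exact: sym_ricci_tensor2.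
move=> a1 a2 a3 b1 b2 b3 c1 c2 c3; rewrite codazziE alpha0 beta0.
by apply: smooth_ext => p; rewrite !smoothE; ring.
Qed.
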